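(* Let $n\ge 2$ be an integer and let $R\in \mathrm{M}_n$ be an upper triangular Toeplitz matrix $$R=\begin{bmatrix} z_0&z_1&z_2&\cdots&z_{n-1}\\ 0&z_0&z_1&\ddots&\vdots\\ 0&0&\ddots&\ddots&z_2\\ \vdots&&\ddots&\ddots&z_1\\ 0&\cdots&\cdots&0&z_0\end{bmatrix},\qquad z_0,z_1,\dots,z_{n-1}\in\mathbb{C},$$ (that is, $R_{ij}=z_{j-i}$ for $i\le j$ and $R_{ij}=0$ for $i>j$) with $z_1\neq 0$. If $A\in \mathrm{M}_n$ is any matrix for which $\|f(A)\|=\|f(R)\|$ for all polynomials $f\in\mathbb{C}[t]$, then $A$ is unitarily similar to $R$, i.e. there is a unitary matrix $U\in\mathrm{M}_n$ such that $A=U^*RU$.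
   Context: $\mathrm{M}_n$ denotes the algebra of all $n\times n$ complex matrices. The norm is $\|A\|=\sqrt{\mathrm{spr}(A^*A)}$, where $\mathrm{spr}$ is the spectral radius; that is, $\|A\|$ is the operator (spectral) norm of $A$ on $\mathbb{C}^n$ with the standard inner product, equivalently the largest singular value of $A$. $\mathbb{C}[t]$ is the ring of polynomials in one variable with complex coefficients. *)

(* Defs.v *)
From HB Require Import structures.
From mathcomp Require Import all_boot all_order all_algebra.
From mathcomp Require Import complex.
From mathcomp Require Import boolp classical_sets reals.

Set Implicit Arguments.
Unset Strict Implicit.
Unset Printing Implicit Defensive.

Import GRing.Theory Num.Theory.
Local Open Scope ring_scope.
Local Open Scope classical_set_scope.
Local Open Scope sesquilinear_scope.

(* The complex numbers are R[i] over an arbitrary model R of the reals;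
   Normc.normc is the complex modulus with values in R. *)

(* For n > 0 the set below is finite and nonempty, so the supremum is the
   maximum modulus of an eigenvalue. *)
Definition spr (R : realType) (n : nat) (A : 'M[R[i]]_n) : R :=
  sup [set r | exists2 a : R[i], eigenvalue A a & r = Normc.normc a].

Definition opnorm (R : realType) (n : nat) (A : 'M[R[i]]_n) : R :=
  Num.sqrt (spr (A ^t* *m A)).

(* The index j - i is below n.+1 whenever i <= j, so inord does not truncate. *)
Definition toeplitz_ut (K : nzRingType) (n : nat) (z : 'I_n.+1 -> K) :
    'M[K]_n.+1 :=
  \matrix_(i, j) if (i <= j)%N then z (inord (j - i)) else 0.

(* Main.v *)
Require Import Defs.
From mathcomp Require Import all_boot all_order all_algebra.
From mathcomp Require Import complex reals.
From mathcomp Require Import classical_sets.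

(** Write [N] for the nilpotent shift, so that the Toeplitz matrix is [p(N)]
    with [p] the polynomial of coefficients [z_0, ..., z_(n-1)].  As [z_1] is
    nonzero, [p] has a compositional inverse [h] modulo [X^n], whence
    [h(R) = N] ([comp_poly_inverse_mod]).  Put [B = h(A)].  The norm
    hypothesis at [X - p(h(X))] shows that [A - p(B)] has norm [0], so
    [A = p(B)]; the norm hypothesis at [f(h(X))] shows that
    [f(B)] and [f(N)] have the same norm for every [f].  It is therefore enough
    to treat the shift: a unitary similarity from [B] to [N] is one from
    [A = p(B)] to [R = p(N)].

    For the shift only three instances matter: [B^n = 0], [B] has norm [1], and
    [B^(n-1)] has norm [1].  Choose a unit vector [u] at which the norm of
    [B^(n-1)] is attained.  Since [B] is a contraction, every vector of the orbit
    [u, Bu, ..., B^(n-1)u] has norm [1], so [B] preserves norms along the orbit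
    up to the last step.  A contraction that preserves the norm of [y] satisfies
    [B^* B y = y] ([contraction_isometric_vector]); hence the inner product of
    [B^j u] and [B^k u] with [j < k] does not change when both exponents are
    raised by one, and raising them until the second one is [n] makes it [0].
    The orbit is an orthonormal basis on which [B] acts as the shift
    ([contraction_similar_shift]).

    Everything is phrased with row vectors, on which the adjoint of the matrix
    under study acts from the right: [|v A^*|] is the norm of [A] applied to the
    conjugate transpose of [v].  The operator norm enters through two facts, both
    from the spectral theorem for [A^* A]: its square bounds [|v A^*|^2 / |v|^2],
    and this bound is attained ([opnorm_sqr_attained]). *)

Set Implicit Arguments.
Unset Strict Implicit.
Unset Printing Implicit Defensive.

Import Order.TTheory GRing.Theory Num.Theory.

Local Open Scope ring_scope.
Local Open Scope sesquilinear_scope.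

Local Notation "''[' u , v ]" := (dotmx u v) : ring_scope.
Local Notation "''[' u ]" := (dotmx u u) : ring_scope.

(** * The Hermitian inner product on row vectors *)

Lemma dotmx_ge0 (C : numClosedFieldType) n (v : 'rV[C]_n) : 0 <= '[v].
Proof. exact: dnorm_ge0. Qed.

Lemma dotmx_gt0 (C : numClosedFieldType) n (v : 'rV[C]_n) : (0 < '[v]) = (v != 0).
Proof. exact: dnorm_gt0. Qed.

Lemma dotmx_le0 (C : numClosedFieldType) n (v : 'rV[C]_n) : '[v] <= 0 -> v = 0.
Proof.
by move=> v_le0; apply/eqP; rewrite -(dnorm_eq0 (@dotmx C n)) eq_le v_le0 dotmx_ge0.
Qed.

Lemma dotmxZ (C : numClosedFieldType) n (a : C) (v : 'rV[C]_n) :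
  '[a *: v] = `|a| ^+ 2 * '[v].
Proof. exact: dnormZ. Qed.

Lemma dotmx_delta (C : numClosedFieldType) n (i : 'I_n) :
  '[delta_mx 0 i : 'rV[C]_n] = 1.
Proof.
rewrite dotmxE mxE (bigD1 i) //= big1 ?addr0 => [|j /negPf ji];
  by rewrite !mxE ?ji ?eqxx ?mul0r // conjC1 mulr1.
Qed.

Lemma dotmx_sum (C : numClosedFieldType) n (w : 'rV[C]_n) :
  '[w] = \sum_i `|w 0 i| ^+ 2.
Proof. by rewrite dotmxE mxE; apply: eq_bigr => i _; rewrite !mxE normCK. Qed.

Lemma dotmx_diag (C : numClosedFieldType) n (w d : 'rV[C]_n) :
  '[w *m diag_mx d, w] = \sum_i d 0 i * `|w 0 i| ^+ 2.
Proof.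
rewrite dotmxE mxE; apply: eq_bigr => i _.
by rewrite mul_mx_diag !mxE normCK mulrAC mulrC.
Qed.

Lemma exists_unit_scale (C : numClosedFieldType) n (u : 'rV[C]_n) :
  u != 0 -> exists a : C, '[a *: u] = 1.
Proof.
rewrite -dotmx_gt0 => u_gt0; exists (sqrtC '[u])^-1.
rewrite dotmxZ ger0_norm ?invr_ge0 ?sqrtC_ge0 ?dotmx_ge0 //.
by rewrite exprVn sqrtCK mulVf // gt_eqF.
Qed.

Lemma trmxC_mul (C : numClosedFieldType) m n p (A : 'M[C]_(m, n)) (B : 'M_(n, p)) :
  (A *m B) ^t* = B ^t* *m A ^t*.
Proof. by rewrite trmx_mul map_mxM. Qed.

Lemma dotmx_mull (C : numClosedFieldType) m n (u : 'rV[C]_m) (M : 'M_(m, n)) v :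
  '[u *m M, v] = '[u, v *m M ^t*].
Proof. by rewrite !dotmxE trmxC_mul trmxCK mulmxA. Qed.

Lemma dnorm_mul_unitary (C : numClosedFieldType) n (U : 'M[C]_n) v :
  U \is unitarymx -> '[v *m U] = '[v].
Proof. by move=> /unitarymxP UU; rewrite dotmx_mull -mulmxA UU mulmx1. Qed.

Lemma dnorm_eigenvalue (C : numClosedFieldType) n (A : 'M[C]_n) a v :
  v *m (A ^t* *m A) = a *: v -> '[v *m A ^t*] = a * '[v].
Proof.
by move=> va; rewrite -dotmx_mull -mulmxA va linearZl_LR.
Qed.

(** * The operator norm as an attained maximum *)

(** In an orthonormal eigenbasis of the Hermitian matrix [A^* A] the form
    [|v A^*|^2] is the sum of the eigenvalues weighted by the squared moduli of
    the coordinates of [v], so the largest eigenvalue bounds it. *)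
Lemma max_gram_eigenvalue (C : numClosedFieldType) n (A : 'M[C]_n.+1) :
  exists2 c : C, eigenvalue (A ^t* *m A) c &
    forall v, '[v *m A ^t*] <= c * '[v].
Proof.
set H := A ^t* *m A; pose P := spectralmx H; pose d := spectral_diag H.
have Hherm : H \is hermsymmx.
  by apply/is_hermitianmxP; rewrite expr0 scale1r trmxC_mul trmxCK.
have Punit : P \is unitarymx := spectral_unitarymx H.
have HE : H = P ^t* *m diag_mx d *m P.
  by rewrite -invmx_unitary //; apply/orthomx_spectralP/hermitian_normalmx.
have d_real i : d 0 i \is Num.real.
  by have /mxOverP := hermitian_spectral_diag_real Hherm.
case: (@real_arg_maxP C _ ord0 xpredT (d 0)) => // i _ d_le.
exists (d 0 i) => [|v].
  apply/eigenvalueP; exists (row i P).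
    rewrite -row_mul HE !mulmxA (unitarymxP Punit) mul1mx.
    by apply/rowP => j; rewrite mul_diag_mx !mxE.
  apply/eqP => Pi0; have /row_unitarymxP/(_ i i)/eqP := Punit.
  by rewrite eqxx Pi0 linear0r eq_sym oner_eq0.
rewrite -dotmx_mull -mulmxA -/H HE !mulmxA dotmx_mull dotmx_diag.
rewrite -(@dnorm_mul_unitary _ _ (P ^t*) v) ?trmxC_unitary // dotmx_sum mulr_sumr.
by apply: ler_sum => j _; rewrite ler_wpM2r ?exprn_ge0 //; apply: d_le.
Qed.

(** Each eigenvalue of [A^* A] is the value of [|v A^*|^2 / |v|^2] at an
    eigenvector.  Hence all of them are nonnegative reals and at most the
    [c] of [max_gram_eigenvalue], and the supremum of their moduli is [c]. *)
Lemma opnorm_sqr_attained (R : realType) n (A : 'M[R[i]]_n.+1) :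
  exists2 c : R[i], c = (opnorm A ^+ 2)%:C%C &
    (exists2 u : 'rV_n.+1, u != 0 & '[u *m A ^t*] = c * '[u]) /\
    (forall v : 'rV_n.+1, '[v *m A ^t*] <= c * '[v]).
Proof.
have [c c_eig c_max] := max_gram_eigenvalue A.
have eig_bounds a : eigenvalue (A ^t* *m A) a -> 0 <= a <= c.
  case/eigenvalueP => v /dnorm_eigenvalue va; rewrite -dotmx_gt0 => v_gt0.
  rewrite -(pmulr_lge0 a v_gt0) -(ler_pM2r v_gt0 a) -va.
  by rewrite dotmx_ge0 c_max.
exists c; last first.
  split=> //; case/eigenvalueP: c_eig => u /dnorm_eigenvalue cu u0.
  by exists u.
have normC_ge0 a : 0 <= a :> R[i] -> (Normc.normc a)%:C%C = a.
  by move=> a_ge0; rewrite -[RHS](ger0_norm a_ge0).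
suff spr_c : spr (A ^t* *m A) = Normc.normc c.
  case/andP: (eig_bounds c c_eig) => c_ge0 _.
  by rewrite /opnorm spr_c sqr_sqrtr -?lecR normC_ge0.
have ub_c : ubound [set r | exists2 a, eigenvalue (A ^t* *m A) a &
    r = Normc.normc a]%classic (Normc.normc c).
  move=> _ [a /eig_bounds/andP[a_ge0 ac] ->].
  by rewrite -lecR !normC_ge0 // (le_trans a_ge0).
apply/le_anti/andP; split.
  by apply: ge_sup => //; exists (Normc.normc c), c.
by apply: ub_le_sup; [exists (Normc.normc c) | exists c].
Qed.

Lemma opnorm_sqr_le (R : realType) n (A : 'M[R[i]]_n.+1) (b : R[i]) :
  (forall v : 'rV_n.+1, '[v *m A ^t*] <= b * '[v]) -> (opnorm A ^+ 2)%:C%C <= b.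
Proof.
move=> A_b; have [c <- [[u u0 cu] _]] := opnorm_sqr_attained A.
by rewrite -(@ler_pM2r _ '[u]) ?dotmx_gt0 // -cu.
Qed.

Lemma opnorm_eq_opnorm0 (R : realType) n (A : 'M[R[i]]_n.+1) :
  opnorm A = opnorm (0 : 'M[R[i]]_n.+1) -> A = 0.
Proof.
move=> A0; have [c cE [_ A_le]] := opnorm_sqr_attained A.
have c_le0 : c <= 0.
  rewrite cE A0; apply: opnorm_sqr_le => v.
  by rewrite mul0r trmx0 map_mx0 mulmx0 linear0r.
suff At0 : A ^t* = 0 by rewrite -[A]trmxCK At0 trmx0 map_mx0.
apply/row_matrixP => j; rewrite rowE row0; apply: dotmx_le0.
by apply: le_trans (A_le _) _; exact: mulr_le0_ge0 c_le0 (dotmx_ge0 _).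
Qed.

(** * The nilpotent shift and Toeplitz matrices *)

Definition shift_mx (K : nzRingType) n : 'M[K]_n := \matrix_(i, j) (i.+1 == j)%:R.

Lemma shift_mxX (K : nzRingType) n k :
  shift_mx K n.+1 ^+ k = \matrix_(i, j) (i + k == j :> nat)%N%:R.
Proof.
elim: k => [|k IHk].
  by apply/matrixP => i j; rewrite expr0 !mxE addn0.
apply/matrixP => i j; rewrite exprS IHk !mxE.
have [i_lt|i_ge] := ltnP i.+1 n.+1.
  rewrite (bigD1 (Ordinal i_lt)) //= big1 ?addr0 => [|l l_ne].
    by rewrite !mxE eqxx mul1r addSnnS.
  rewrite !mxE [_ == _]negbTE ?mul0r //.
  by apply: contra l_ne => /eqP il; apply/eqP/val_inj.
rewrite big1 => [|l _]; rewrite ?mxE.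
  by rewrite [_ == _]gtn_eqF // (leq_trans (ltn_ord j)) // addnS (leq_trans i_ge) // leq_addr.
by rewrite [_ == _]gtn_eqF ?mul0r // (leq_trans (ltn_ord l)).
Qed.

Lemma shift_mx_nilpotent (K : nzRingType) n : shift_mx K n.+1 ^+ n.+1 = 0.
Proof.
apply/matrixP => i j; rewrite shift_mxX !mxE gtn_eqF //.
by rewrite (leq_trans (ltn_ord j)) // leq_addl.
Qed.

Lemma toeplitz_ut_horner (K : comNzRingType) n (z : 'I_n.+1 -> K) :
  toeplitz_ut z = horner_mx (shift_mx K n.+1) (\poly_(k < n.+1) z (inord k)).
Proof.
rewrite poly_def rmorph_sum /=; apply/matrixP => i j; rewrite summxE mxE.
have entry (k : 'I_n.+1) : horner_mx (shift_mx K n.+1) (z (inord k) *: 'X^k) i j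
    = z (inord k) * (i + k == j :> nat)%N%:R.
  by rewrite horner_mxZ rmorphXn /= horner_mx_X shift_mxX !mxE.
under eq_bigr do rewrite entry.
have [ij|ji] := leqP i j; last first.
  rewrite big1 // => k _; rewrite gtn_eqF ?mulr0 //.
  by rewrite (leq_trans ji) // leq_addr.
have lt_ji : (j - i < n.+1)%N by rewrite (leq_ltn_trans (leq_subr _ _)).
rewrite (bigD1 (Ordinal lt_ji)) //= subnKC // eqxx mulr1 big1 ?addr0 // => k k_ne.
rewrite [_ == _]negbTE ?mulr0 //; apply: contra k_ne => /eqP ij_k.
by apply/eqP/val_inj; rewrite /= -ij_k addKn.
Qed.

Lemma dnorm_mul_shift_le (C : numClosedFieldType) n (v : 'rV[C]_n.+1) :
  '[v *m (shift_mx C n.+1) ^t*] <= '[v].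
Proof.
rewrite !dotmx_sum big_ord_recr big_ord_recl /= addrC lerD //.
  rewrite mxE big1 ?normr0 ?expr0n ?exprn_ge0 // => j _.
  by rewrite !mxE gtn_eqF ?mulr0n ?conjC0 ?mulr0.
apply: ler_sum => i _; rewrite mxE (bigD1 (lift ord0 i)) //= big1 ?addr0 => [|j j_ne].
  by rewrite !mxE eqxx conjC1 mulr1.
by rewrite !mxE [_ == _]negbTE ?conjC0 ?mulr0 // eq_sym.
Qed.

(** The power [N^n] moves the last basis vector to the first one, so its norm is
    at least [1]. *)
Lemma dnorm_last_mul_shiftX (C : numClosedFieldType) n :
  '[delta_mx 0 ord_max *m (shift_mx C n.+1 ^+ n) ^t*] = 1.
Proof.
rewrite -rowE (_ : row _ _ = delta_mx 0 ord0) ?dotmx_delta //.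
apply/rowP => j; rewrite shift_mxX !mxE /= -[X in (_ == X)%N]add0n eqn_add2r.
by rewrite conjC_nat.
Qed.

(** * Polynomial calculus *)

(** The inverse [h] is built one coefficient at a time.  If
    [X - h(p) = r X^k] and [p = q X + c], then [(p - c)^k = q^k X^k], so adding
    [a (X - c)^k] to [h] replaces [r] with [r - a q^k]; as
    [q(0) = p_1] is nonzero, [a] can be chosen to make this vanish at [0]. *)
Lemma comp_poly_inverse_mod (F : fieldType) (p : {poly F}) k :
  p`_1 != 0 -> exists h, 'X^k %| 'X - (h \Po p).
Proof.
move=> p1_neq0; set c := p`_0.
have dvdX (q : {poly F}) : q.[0] = 0 -> 'X %| q.
  by move=> q0; rewrite -['X]subr0 dvdp_XsubCl /root q0.
have [q pE] : exists q, p = q * 'X + c%:P.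
  have /dvdpP[q pE] : 'X %| p - c%:P by rewrite dvdX // !hornerE horner_coef0 subrr.
  by exists q; rewrite -pE subrK.
have q0 : q.[0] != 0.
  by move: p1_neq0; rewrite pE coefD coefMX coefC addr0 horner_coef0.
elim: k => [|k [h /dvdpP[r hE]]]; first by exists 0; rewrite expr0 dvd1p.
pose a := r.[0] / q.[0] ^+ k.
exists (h + a *: ('X - c%:P) ^+ k).
have pXk : ('X - c%:P) ^+ k \Po p = q ^+ k * 'X^k.
  by rewrite rmorphXn /= comp_polyB comp_polyX comp_polyC {1}pE addrK exprMn.
rewrite comp_polyD comp_polyZ pXk opprD addrA hE scalerAl -mulrBl exprS.
rewrite dvdp_mul2r ?expf_neq0 ?polyX_eq0 // dvdX //.
by rewrite !hornerE divfK ?subrr // expf_neq0.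
Qed.

Lemma horner_mx_comp (K : comNzRingType) n (A : 'M[K]_n.+1) (h p : {poly K}) :
  horner_mx A (h \Po p) = horner_mx (horner_mx A p) h.
Proof.
elim/poly_ind: h => [|h b IHh]; first by rewrite comp_poly0 !rmorph0.
rewrite comp_polyD comp_polyM comp_polyX comp_polyC !rmorphD !rmorphM /=.
by rewrite IHh !horner_mx_X !horner_mx_C.
Qed.

Lemma horner_mx_unitary_conj (C : numClosedFieldType) n (U A : 'M[C]_n.+1) p :
  U \is unitarymx ->
  horner_mx (U ^t* *m A *m U) p = U ^t* *m horner_mx A p *m U.
Proof.
by move=> Uu; rewrite -invmx_unitary // horner_mx_uconjC ?[_ \is a _]unitarymx_unit.
Qed.

(** * Contractions with an isometric orbit *)

(** Let [w = y T T^*].  The inner product of [y T] and [w T] is [|w|^2] and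
    [|w T| <= |w|], so expanding [0 <= |y T - w T|^2] gives
    [|w|^2 <= |y|^2]; since the inner product of [y] and [w] is
    [|y T|^2 = |y|^2], expanding [|y - w|^2] then gives [|y - w|^2 <= 0]. *)
Lemma contraction_isometric_vector (C : numClosedFieldType) n (T : 'M[C]_n) y :
  (forall v, '[v *m T] <= '[v]) -> '[y *m T] = '[y] -> y *m T *m T ^t* = y.
Proof.
move=> T_le yT; set w := y *m T *m T ^t*.
have yw : '[y, w] = '[y] by rewrite -dotmx_mull yT.
have yTwT : '[y *m T, w *m T] = '[w].
  by rewrite -{2}[T]trmxCK -dotmx_mull.
have w_le : '[w] <= '[y].
  have w_real := ger0_real (dotmx_ge0 w).
  have := dotmx_ge0 (y *m T - w *m T).
  rewrite dnormB /= yTwT (CrealP w_real) yT opprD addrA subr_ge0.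
  rewrite lerBrDr => w2_le; rewrite -(lerD2r '[w]) (le_trans w2_le) //.
  by rewrite lerD2l.
have y_real := ger0_real (dotmx_ge0 y).
apply/esym/eqP; rewrite -subr_eq0; apply/eqP/dotmx_le0.
by rewrite dnormB /= yw (CrealP y_real) subr_le0 lerD2l.
Qed.

(** The rows of the unitary matrix are the orbit [u T^n, ..., u T, u], in this
    order because [T] has to act on them as the transpose of the shift, which
    sends each row to the previous one. *)
Lemma contraction_similar_shift (C : numClosedFieldType) n (T : 'M[C]_n.+1) u :
    (forall v, '[v *m T] <= '[v]) -> T ^+ n.+1 = 0 ->
    '[u] = 1 -> '[u] <= '[u *m T ^+ n] ->
  exists2 V : 'M[C]_n.+1, V \is unitarymx & T ^t* = V ^t* *m shift_mx C n.+1 *m V.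
Proof.
move=> T_le Tn0 u1 uTn; pose x k := u *m T ^+ k.
have xS k : x k.+1 = x k *m T by rewrite /x exprSr mulmxA.
have x_anti k l : (k <= l)%N -> '[x l] <= '[x k].
  move/subnKC <-; elim: (l - k)%N => [|m]; first by rewrite addn0.
  by apply: le_trans; rewrite addnS xS.
have x_norm k : (k <= n)%N -> '[x k] = 1.
  move=> kn; apply/le_anti; rewrite -{2}u1 (le_trans uTn (x_anti _ _ kn)) andbT.
  by rewrite -u1 (le_trans (x_anti 0 k _)) // /x expr0 mulmx1.
have x_iso j k : (j < n)%N -> '[x j.+1, x k.+1] = '[x j, x k].
  move=> jn; rewrite !xS -{2}[T]trmxCK -dotmx_mull.
  by rewrite contraction_isometric_vector // -xS !x_norm // ltnW.
(* Raising both exponents by one keeps the product, and it is zero once the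
   larger exponent reaches [n.+1]. *)
have x_orth j k : (j < k)%N -> (k <= n.+1)%N -> '[x j, x k] = 0.
  move=> jk /subnKC; move: (n.+1 - k)%N => m; elim: m j k jk => [|m IHm] j k jk.
    by rewrite addn0 => ->; rewrite /x Tn0 mulmx0 linear0r.
  move=> kmn; rewrite -x_iso ?IHm ?addSnnS //.
  by rewrite -ltnS (leq_ltn_trans jk) // -kmn addnS ltnS leq_addr.
pose V : 'M[C]_n.+1 := \matrix_i x (n - i)%N.
have Vu : V \is unitarymx.
  apply/row_unitarymxP => i j; rewrite !rowK.
  have [ij|ji|/val_inj->] := ltngtP i j; last by rewrite x_norm ?leq_subr ?eqxx.
    rewrite (negbTE (_ : i != j)) ?neq_ltn ?ij //; apply/eqP.
    rewrite (herm_eq0C (@dotmx C _)); apply/eqP/x_orth; last first.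
      by rewrite (leq_trans (leq_subr _ _)).
    by rewrite ltn_sub2l // (leq_trans ij) // -ltnS.
  rewrite (negbTE (_ : i != j)) ?neq_ltn ?ji ?orbT // x_orth //.
    by rewrite ltn_sub2l // (leq_trans ji) // -ltnS.
  by rewrite (leq_trans (leq_subr _ _)).
suff VT : V *m T = (shift_mx C n.+1)^T *m V.
  have -> : T = V ^t* *m (V *m T).
    by rewrite mulmxA -(invmx_unitary Vu) mulVmx ?unitarymx_unit // mul1mx.
  have N_real : shift_mx C n.+1 ^ Num.conj = shift_mx C n.+1.
    by apply/matrixP => i j; rewrite !mxE conjC_nat.
  by exists V; rewrite // VT !trmxC_mul trmxCK trmxK N_real.
apply/row_matrixP => i; rewrite !row_mul rowK -xS.
rewrite mulmx_sum_row; under eq_bigr do rewrite rowK !mxE.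
case: i => -[|i] lt_i /=.
  rewrite subn0 big1 => [|k _]; rewrite ?scale0r //.
  by rewrite /x Tn0 mulmx0.
rewrite (bigD1 (Ordinal (ltnW lt_i))) //= eqxx scale1r big1 ?addr0 => [|k k_ne].
  by rewrite subnSK.
by rewrite [_ == _]negbTE ?scale0r.
Qed.

(** The adjoint of [B] satisfies the assumptions of
    [contraction_similar_shift]: it is a contraction because the shift is one,
    and [B^n] attains on some unit vector a norm that is at least [1] because it
    is that of [N^n]. *)
Lemma opnorm_shift_similar (R : realType) n (B : 'M[R[i]]_n.+1) :
    B ^+ n.+1 = 0 ->
    opnorm B = opnorm (shift_mx R[i] n.+1) ->
    opnorm (B ^+ n) = opnorm (shift_mx R[i] n.+1 ^+ n) ->
  exists2 V : 'M[R[i]]_n.+1, V \is unitarymx & B = V ^t* *m shift_mx R[i] n.+1 *m V.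
Proof.
set N := shift_mx _ _ => Bn0 eqB eqBn.
have trXC (M : 'M[R[i]]_n.+1) k : (M ^t*) ^+ k = (M ^+ k) ^t*.
  elim: k => [|k IHk]; first by rewrite !expr0 trmx1 map_mx1.
  by rewrite exprSr IHk exprS; apply/esym/trmxC_mul.
have B_le (v : 'rV_n.+1) : '[v *m B ^t*] <= '[v].
  have [c cE [_ /(_ v) /le_trans]] := opnorm_sqr_attained B; apply.
  apply: ler_piMl; first exact: dotmx_ge0.
  rewrite cE eqB.
  by apply: opnorm_sqr_le => w; rewrite mul1r; apply: dnorm_mul_shift_le.
have [u u1 uB] : exists2 u : 'rV_n.+1, '[u] = 1 & 1 <= '[u *m (B ^+ n) ^t*].
  have [c cE [[u u0 uc] _]] := opnorm_sqr_attained (B ^+ n).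
  have c_ge1 : 1 <= c.
    have [d dE [_ /(_ (delta_mx 0 ord_max))]] := opnorm_sqr_attained (N ^+ n).
    by rewrite dnorm_last_mul_shiftX dotmx_delta mulr1 cE eqBn -dE.
  have [a a1] := exists_unit_scale u0.
  exists (a *: u); first exact: a1.
  by rewrite -scalemxAl dotmxZ uc mulrCA -dotmxZ a1 mulr1.
have Bt0 : (B ^t*) ^+ n.+1 = 0 by rewrite trXC Bn0 trmx0 map_mx0.
have [|V Vu VB] := contraction_similar_shift B_le Bt0 u1; first by rewrite u1 trXC.
exists V; first exact: Vu.
by rewrite -VB trmxCK.
Qed.

(** * Unitary similarity to the Toeplitz matrix *)

Theorem theorem2p1 (R : realType) (n : nat) (z : 'I_n.+2 -> R[i])
    (z1_neq0 : z (inord 1) != 0) (A : 'M[R[i]]_n.+2)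
    (eq_norm : forall f : {poly R[i]},
       opnorm (horner_mx A f) = opnorm (horner_mx (toeplitz_ut z) f)) :
  exists2 U : 'M[R[i]]_n.+2, U \is unitarymx &
    A = U ^t* *m toeplitz_ut z *m U.
Proof.
pose N := shift_mx R[i] n.+2; pose p := \poly_(k < n.+2) z (inord k).
have RE : toeplitz_ut z = horner_mx N p := toeplitz_ut_horner z.
have p1_neq0 : p`_1 != 0 by rewrite coef_poly.
have [h /dvdpP[q hE]] := @comp_poly_inverse_mod _ p n.+2 p1_neq0.
have hR : horner_mx (toeplitz_ut z) h = N.
  apply/esym/eqP; rewrite -subr_eq0 RE -horner_mx_comp -{1}(horner_mx_X N) -rmorphB hE.
  by rewrite rmorphM rmorphXn /= horner_mx_X shift_mx_nilpotent mulr0.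
pose B := horner_mx A h.
have eq_normB f : opnorm (horner_mx B f) = opnorm (horner_mx N f).
  by rewrite -!horner_mx_comp eq_norm horner_mx_comp hR.
have AE : A = horner_mx B p.
  apply/eqP; rewrite -subr_eq0; apply/eqP/opnorm_eq_opnorm0.
  rewrite -{1}(horner_mx_X A) -horner_mx_comp -rmorphB eq_norm rmorphB /=.
  by rewrite horner_mx_comp hR horner_mx_X -RE subrr.
have hornerXn (M : 'M[R[i]]_n.+2) k : horner_mx M 'X^k = M ^+ k.
  by rewrite rmorphXn /= horner_mx_X.
have Bn0 : B ^+ n.+2 = 0.
  by apply: opnorm_eq_opnorm0; rewrite -hornerXn eq_normB hornerXn shift_mx_nilpotent.
have [||U Uu BE] := opnorm_shift_similar Bn0.
- by rewrite -[B]horner_mx_X eq_normB horner_mx_X.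
- by rewrite -hornerXn eq_normB hornerXn.
exists U; first exact: Uu.
rewrite RE AE BE.
exact: horner_mx_unitary_conj.
Qed.
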